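(* Let $A\in\mathbb{R}^{n\times n}$ and $B=\begin{bmatrix}I_m\\0\end{bmatrix}\in\mathbb{R}^{n\times m}$. Suppose that the leader set $\mathcal{L}=[1,m]$ and the follower classes $\mathcal{F}_1,\dots,\mathcal{F}_K$ of the graph $\mathcal{G}(A)$ satisfy the leader–follower assumption described in the context, so that the controllability matrix in $K+1$ steps has the block form $$\mathcal{R}_{K+1}=[\,B\;|\;AB\;|\;A^2B\;|\;\cdots\;|\;A^KB\,]=\begin{bmatrix} I_m & * & * & \cdots & *\\ 0&\Phi_1&*&\cdots&*\\ 0&0&\Phi_2&\cdots&*\\ \vdots&\vdots&\vdots&\ddots&\vdots\\ 0&0&0&\cdots&\Phi_K\end{bmatrix},$$ with row blocks of sizes $m,m_1,\dots,m_K$ and $\Phi_k\in\mathbb{R}^{m_k\times m}$, and suppose that every matrix $\Phi_k$, $k\in[1,K]$, has no zero rows. For every $k\in[1,K]$ define $$J_k:=\{j\in[1,m]:\Phi_k\mathbf{e}_j\text{ is unisigned}\},\qquad \mathcal{H}_k:=\bigcup_{j\in J_k}\overline{\mathrm{ZP}}(\Phi_k\mathbf{e}_j).$$ If $|\mathcal{H}_k|\ge m_k-1$ for every $k\in[1,K]$, then the pair $(A,B)$ is herdable.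
   Context: For integers $k\le n$, $[k,n]$ denotes the integer set $\{k,\dots,n\}$. $\mathbf{e}_j$ is the $j$-th canonical basis vector, so $M\mathbf{e}_j$ is the $j$-th column of $M$. For a vector $\mathbf{v}$, $\overline{\mathrm{ZP}}(\mathbf{v})=\{i:[\mathbf{v}]_i\neq 0\}$. A nonzero vector is unisigned if all its nonzero entries have the same sign (the zero vector is not unisigned). In the displayed block matrix $*$ denotes blocks whose values are not relevant. Graph: $\mathcal{G}(A)$ is the signed weighted directed graph with vertex set $[1,n]$ and an arc $(j,i)$ from $j$ to $i$, of weight $[A]_{ij}$, if and only if $[A]_{ij}\neq0$. The distance $d(j,i)$ is the minimal length of a walk from $j$ to $i$, and $d(\mathcal{L},j)=\min_{i\in\mathcal{L}}d(i,j)$. Leader–follower assumption: the leaders are $\mathcal{L}=[1,m]$ and the followers are $\mathcal{F}=[m+1,n]$. For $k\ge1$ let $\mathcal{F}_k=\{j\in\mathcal{F}:d(\mathcal{L},j)=k\}$ and $m_k=|\mathcal{F}_k|$. It is assumed that every follower has finite distance from $\mathcal{L}$, that $K$ is the maximum such distance ($\mathcal{F}_K\neq\emptyset$ and $\mathcal{F}_k=\emptyset$ for $k>K$), and that the followers are ordered so that $\mathcal{F}_1=[m+1,m+m_1]$, and in general $\mathcal{F}_k=[m+m_1+\cdots+m_{k-1}+1,\,m+m_1+\cdots+m_k]$; thus $m+m_1+\cdots+m_K=n$. With this ordering, $\Phi_k$ is the block of $A^kB$ formed by the rows indexed by $\mathcal{F}_k$. Herdability: the pair $(A,B)$ describes the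 linear time-invariant system $\dot{\mathbf{x}}(t)=A\mathbf{x}(t)+B\mathbf{u}(t)$ (or its discrete-time counterpart $\mathbf{x}(t+1)=A\mathbf{x}(t)+B\mathbf{u}(t)$). The pair is (completely) herdable if for every $\mathbf{x}(0)$ and every $h>0$ there exist a time $t_f>0$ and an input $\mathbf{u}(t)$, $t\in[0,t_f)$, driving the state from $\mathbf{x}(0)$ to some $\mathbf{x}(t_f)\ge h\mathbf{1}_n$ (entrywise, $\mathbf{1}_n$ the all-ones vector). It is known that (in both continuous and discrete time) this is equivalent to the image (column space) of the controllability matrix $[B\,|\,AB\,|\,\cdots\,|\,A^{n-1}B]$ containing a vector all of whose entries are positive. *)

(* Defs.v *)
From HB Require Import structures.
From mathcomp Require Import all_boot all_order all_algebra.
From mathcomp Require Import all_classical all_reals all_analysis.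
Set Implicit Arguments.
Unset Strict Implicit.
Unset Printing Implicit Defensive.
Import Order.TTheory GRing.Theory Num.Theory.
Import numFieldNormedType.Exports.
Local Open Scope ring_scope.

(* Vertices 1, ..., n are encoded as the ordinals 0, ..., n-1, so the leaders are
   the i with i < m. *)

(* The input is taken continuous on [0, tf] and the state is a classical
   solution: continuous on [0, tf] and differentiable inside.  Entrywise, so
   that no norm on matrices is involved. *)
Definition ct_trajectory (R : realType) (n m : nat) (A : 'M[R]_n)
    (B : 'M[R]_(n, m)) (tf : R) (u : R -> 'cV[R]_m) (x : R -> 'cV[R]_n) : Prop :=
  [/\ forall j : 'I_m, {within `[0, tf], continuous (fun t => u t j ord0)}%classic,
      forall i : 'I_n, {within `[0, tf], continuous (fun t => x t i ord0)}%classic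
    & forall (t : R) (i : 'I_n), 0 < t < tf ->
        is_derive t 1 (fun s => x s i ord0) ((A *m x t + B *m u t) i ord0)].

Definition herdable_ct (R : realType) (n m : nat) (A : 'M[R]_n)
    (B : 'M[R]_(n, m)) : Prop :=
  forall (x0 : 'cV[R]_n) (h : R), 0 < h ->
    exists (tf : R) (u : R -> 'cV[R]_m) (x : R -> 'cV[R]_n),
      [/\ 0 < tf, ct_trajectory A B tf u x, x 0 = x0
        & forall i : 'I_n, h <= x tf i ord0].

Definition herdable_dt (R : realType) (n m : nat) (A : 'M[R]_n)
    (B : 'M[R]_(n, m)) : Prop :=
  forall (x0 : 'cV[R]_n) (h : R), 0 < h ->
    exists (tf : nat) (u : nat -> 'cV[R]_m) (x : nat -> 'cV[R]_n),
      [/\ (0 < tf)%N,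
          forall t : nat, (t < tf)%N -> x t.+1 = A *m x t + B *m u t,
          x 0%N = x0
        & forall i : 'I_n, h <= x tf i ord0].

(* The pair (A, B) stands for either system, so both are required. *)
Definition herdable (R : realType) (n m : nat) (A : 'M[R]_n)
    (B : 'M[R]_(n, m)) : Prop :=
  herdable_ct A B /\ herdable_dt A B.

(* [arc A j i] is an arc from j to i: note the transposition. *)
Definition arc (R : realType) (n : nat) (A : 'M[R]_n) : rel 'I_n :=
  fun j i => A i j != 0.

Definition walk (R : realType) (n : nat) (A : 'M[R]_n) (j i : 'I_n)
    (k : nat) : Prop :=
  exists p : seq 'I_n, [/\ path (arc A) j p, last j p = i & size p = k].

(* Distances may be infinite; [is_dist A j i k] reads "d(j, i) = k < oo", and
   d(j, i) is infinite when no such k exists.  Likewise for [is_set_dist]. *)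
Definition is_dist (R : realType) (n : nat) (A : 'M[R]_n) (j i : 'I_n)
    (k : nat) : Prop :=
  walk A j i k /\ forall l : nat, walk A j i l -> (k <= l)%N.

Definition is_set_dist (R : realType) (n : nat) (A : 'M[R]_n) (L : {set 'I_n})
    (j : 'I_n) (k : nat) : Prop :=
  (exists2 i : 'I_n, i \in L & is_dist A i j k) /\
  forall (i : 'I_n) (l : nat), i \in L -> is_dist A i j l -> (k <= l)%N.

Definition leaders (n m : nat) : {set 'I_n} := [set i : 'I_n | (i < m)%N]%SET.

Definition followers (n m : nat) : {set 'I_n} := [set i : 'I_n | (m <= i)%N]%SET.

Definition follower_class (R : realType) (n m : nat) (A : 'M[R]_n)
    (k : nat) : {set 'I_n} :=
  [set j in followers n m | `[< is_set_dist A (leaders n m) j k >] ]%SET.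

(* [lf_nonempty] forces 0 < K, since followers are never at distance 0. *)
Record leader_follower (R : realType) (n m : nat) (A : 'M[R]_n)
    (K : nat) : Prop := LeaderFollower {
  lf_finite : forall j : 'I_n, j \in followers n m ->
    exists k : nat, is_set_dist A (leaders n m) j k;
  lf_nonempty : follower_class m A K <> finset.set0;
  lf_max : forall k : nat, (K < k)%N -> follower_class m A k = finset.set0;
  lf_order : forall k : nat, (1 <= k <= K)%N ->
    follower_class m A k =
    [set i : 'I_n | (m + \sum_(1 <= l < k) #|follower_class m A l| <= i
                     < m + \sum_(1 <= l < k.+1) #|follower_class m A l|)%N]%SET
}.

(* The n x m matrix with block rows I_m and 0, for m <= n. *)
Definition leader_input (R : realType) (n m : nat) : 'M[R]_(n, m) := pid_mx m.

(* [enum_val] lists the vertices of the class in increasing order. *)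
Definition Phi (R : realType) (n m : nat) (A : 'M[R]_n) (k : nat) :
    'M[R]_(#|follower_class m A k|, m) :=
  rowsub (fun i : 'I_(#|follower_class m A k|) => enum_val i)
         (A ^+ k *m leader_input R n m).

Definition nonzero_pattern (R : realType) (p : nat) (v : 'cV[R]_p) : {set 'I_p} :=
  [set i : 'I_p | v i ord0 != 0]%SET.

Definition unisigned (R : realType) (p : nat) (v : 'cV[R]_p) : bool :=
  (v != 0) &&
  [forall i in nonzero_pattern v, forall j in nonzero_pattern v,
     Num.sg (v i ord0) == Num.sg (v j ord0)].

Definition unisigned_columns (R : realType) (n m : nat) (A : 'M[R]_n)
    (k : nat) : {set 'I_m} :=
  [set j : 'I_m | unisigned (col j (Phi m A k))]%SET.

Definition unisigned_support (R : realType) (n m : nat) (A : 'M[R]_n)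
    (k : nat) : {set 'I_(#|follower_class m A k|)} :=
  (\bigcup_(j in unisigned_columns m A k) nonzero_pattern (col j (Phi m A k)))%SET.

(* Main.v *)
Require Import Defs.
From mathcomp Require Import all_boot all_order all_algebra.
From mathcomp Require Import all_classical all_reals all_analysis.
From mathcomp Require Import lra.
Set Implicit Arguments.
Unset Strict Implicit.
Unset Printing Implicit Defensive.
Import Order.TTheory GRing.Theory Num.Theory.
Import numFieldNormedType.Exports.
Local Open Scope ring_scope.

(** The proof has a combinatorial half, which finds a positive vector in the
image of the controllability matrix, and a dynamical half, which steers the
state above any threshold once such a vector exists.

Positive vector.  Within one class, weight each unisigned column of [Phi_k] by
its sum of entries: the weighted sum is nonnegative, and positive on the rows
that some unisigned column touches.  All rows but at most one are touched; as
the remaining row is not zero, some column multiplied by a scalar is positive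
there, and a large multiple of the nonnegative sum absorbs what this does to
the other rows.  Hence [Phi_k] has a positive vector in its image
([almost_covered_positive_image]).  The classes are then treated from the
farthest to the nearest: a nonzero entry of [A ^+ k] gives a walk of length
[k], so inputs through [A ^+ k *m B] do not reach followers at distance more
than [k], and a large multiple of a vector positive on class [k] can be added
without spoiling what was achieved beyond it
([leader_follower_positive_ctrb]).

Discrete time.  The controllability combination is itself the state reached
from the origin, so a large multiple of its input dominates the free response.

Continuous time.  If [a] is a trajectory of the discrete system for the input
[u], both of at most geometric growth, then the exponential generating function
[sum_r a_r t^r / r!] is a trajectory of the continuous system, since
differentiating it shifts the coefficients ([egf_ct_trajectory]).  This gives
the free response (the matrix exponential) and many controlled ones.  The
impulse [v] at step [q - 1] leads at time 1 to [E_q (B v)], where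
[E_q z = sum_r A^r z / (q + r)!].  Since [E_q z = z / q! + E_(q+1) (A z)] and
[q! E_(q+1) (A z)] tends to 0 as [q] grows, induction on [k] shows that every
[A^k B v] is a limit of states reachable at time 1
([almost_reachable1_krylov]).  Positivity is an open condition, so a positive
vector of the controllability span has a positive reachable neighbour, which
is scaled up to dominate the free response. *)

(** * Positive vectors in the image of one block *)

Lemma exists_dominating_scale (R : realType) (I : finType) (P : pred I)
    (y z : I -> R) : (forall i, P i -> 0 < z i) ->
  exists2 c, 0 < c & forall i, P i -> y i < c * z i.
Proof.
move=> z_gt0; pose f i := `|y i| / z i.
have f_ge0 i : P i -> 0 <= f i by move=> /z_gt0 zi; rewrite divr_ge0 // ltW.
have S_ge0 : 0 <= \sum_(i | P i) f i by exact: sumr_ge0.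
exists (1 + \sum_(i | P i) f i) => [|i Pi]; first by rewrite ltr_wpDr.
have zi := z_gt0 _ Pi.
rewrite -ltr_pdivrMr // (@le_lt_trans _ _ (f i)) //.
  by rewrite ler_pM2r ?invr_gt0 // ler_norm.
rewrite (@le_lt_trans _ _ (\sum_(i | P i) f i)) ?ltrDr //.
by rewrite (bigD1 i) //= lerDl sumr_ge0 // => j /andP[/f_ge0].
Qed.

Lemma unisigned_mul_ge0 (R : realType) p (v : 'cV[R]_p) i j :
  unisigned v -> 0 <= v i ord0 * v j ord0.
Proof.
move=> /andP[_ /forall_inP us].
have [->|vi] := eqVneq (v i ord0) 0; first by rewrite mul0r.
have [->|vj] := eqVneq (v j ord0) 0; first by rewrite mulr0.
have iN : i \in nonzero_pattern v by rewrite inE.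
have jN : j \in nonzero_pattern v by rewrite inE.
have /forall_inP/(_ _ jN)/eqP sij := us _ iN.
by rewrite -sgr_ge0 sgrM sij -expr2 sqr_ge0.
Qed.

(** The sum of a unisigned column has the sign of its entries, so weighting the
column by it makes the entries nonnegative. *)
Lemma almost_covered_positive_image (R : realType) p m (P : 'M[R]_(p, m)) :
  (forall i, row i P <> 0) ->
  (p - 1 <= #|\bigcup_(j | unisigned (col j P)) nonzero_pattern (col j P)|)%N ->
  exists v : 'cV[R]_m, forall i, 0 < (P *m v) i ord0.
Proof.
set H := (\bigcup_(j | _) _)%SET => Prow cardH.
pose v0 : 'cV[R]_m :=
  \col_j (if unisigned (col j P) then \sum_i P i j else 0).
have term_ge0 i j : 0 <= P i j * v0 j ord0.
  rewrite mxE; case: ifP => [uj|_]; last by rewrite mulr0.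
  rewrite mulr_sumr sumr_ge0 // => i' _.
  by have := unisigned_mul_ge0 i i' uj; rewrite !mxE.
have v0_ge0 i : 0 <= (P *m v0) i ord0 by rewrite mxE sumr_ge0.
have v0_gt0 i : i \in H -> 0 < (P *m v0) i ord0.
  move=> /bigcupP[j uj]; rewrite inE mxE => Pij.
  rewrite mxE (bigD1 j) //= ltr_wpDr ?sumr_ge0 //.
  rewrite mxE uj (bigD1 i) //= mulrDr ltr_wpDr //; last first.
    by rewrite -expr2 exprn_even_gt0.
  rewrite mulr_sumr sumr_ge0 // => i' _.
  by have := unisigned_mul_ge0 i i' uj; rewrite !mxE.
(* At most one row [i0] is untouched; it is repaired with one nonzero entry. *)
have [Hfull|/subsetPn[i0 _ i0H]] := boolP ([set: 'I_p]%SET \subset H).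
  by exists v0 => i; rewrite v0_gt0 // (fintype.subsetP Hfull) ?inE.
have onlyi0 i : i != i0 -> i \in H.
  apply: contra_neqT => iH.
  have : (#|~: H| <= 1)%N.
    by rewrite cardsCs finset.setCK card_ord leq_subCl.
  by move=> /card_le1_eqP; apply; rewrite inE.
have [j Pj] : exists j, P i0 j != 0.
  apply/existsP; apply: contra_notT (Prow i0) => /existsPn Pi0.
  by apply/rowP => j; rewrite !mxE; apply/eqP; rewrite -[_ == _]negbK Pi0.
pose v1 : 'cV[R]_m := P i0 j *: delta_mx j ord0.
have v1E i : (P *m v1) i ord0 = P i0 j * P i j.
  by rewrite -scalemxAr mxE -colE mxE.
have [c c_gt0 cP] := exists_dominating_scale (P := mem H)
  (fun i => - (P *m v1) i ord0) v0_gt0.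
exists (c *: v0 + v1) => i.
rewrite mulmxDr -scalemxAr 2!mxE.
have [->|/onlyi0/cP] := eqVneq i i0; last by rewrite -subr_gt0 opprK.
by rewrite ltr_wpDl ?mulr_ge0 ?(ltW c_gt0) // v1E -expr2 exprn_even_gt0.
Qed.

(** * Distances and the block triangular shape *)

Lemma expmx_neq0_walk (R : realType) n (A : 'M[R]_n) k (i j : 'I_n) :
  (A ^+ k) i j != 0 -> walk A j i k.
Proof.
elim: k j => [|k IH] j.
  rewrite expr0 mxE; have [->|] := eqVneq i j; last by rewrite eqxx.
  by exists [::].
rewrite exprSr mxE => Aij.
have [l /andP[]] : exists l, ((A ^+ k) i l != 0) && (A l j != 0).
  apply/existsP; apply: contraNT Aij => /existsPn Z.
  rewrite big1 // => l _; apply/eqP; rewrite mulf_eq0.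
  by have := Z l; rewrite negb_and !negbK.
move=> /IH[p [pp lp sp]] Alj; exists (l :: p); split => //=.
- by apply/andP.
- by rewrite sp.
Qed.

Lemma set_dist_le_walk (R : realType) n (A : 'M[R]_n) (L : {set 'I_n}) i l d k :
  is_set_dist A L i d -> l \in L -> walk A l i k -> (d <= k)%N.
Proof.
move=> [_ dmin] lL wk.
have ex : exists k, `[< walk A l i k >] by exists k; apply/asboolP.
case: (ex_minnP ex) => d' /asboolP wd' d'min.
apply: (leq_trans (dmin l d' lL _)); last by apply: d'min; apply/asboolP.
by split => // k' wk'; apply: d'min; apply/asboolP.
Qed.

Lemma leader_input_neq0 (R : realType) n m (M : 'M[R]_n) i j :
  (M *m leader_input R n m) i j != 0 ->
  exists2 l, l \in leaders n m & M i l != 0.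
Proof.
rewrite mxE => Mij.
have [l /andP[]] : exists l, (l \in leaders n m) && (M i l != 0).
  apply/existsP; apply: contraNT Mij => /existsPn Z.
  rewrite big1 // => l _; have := Z l; rewrite inE negb_and negbK mxE.
  by case/orP => [/negPf ->|/eqP ->]; rewrite ?andbF ?mulr0 ?mul0r.
by exists l.
Qed.

(** The zero blocks below the diagonal of the controllability matrix: an input
needs at least [d] steps to reach a vertex at distance [d] from the leaders. *)
Lemma early_response_eq0 (R : realType) n m (A : 'M[R]_n) k d i
    (v : 'cV[R]_m) :
  is_set_dist A (leaders n m) i d -> (k < d)%N ->
  (A ^+ k *m leader_input R n m *m v) i ord0 = 0.
Proof.
move=> dist lt_kd; rewrite mxE big1 // => j _.
have [->|/leader_input_neq0[l lL /expmx_neq0_walk wk]] :=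
  eqVneq ((A ^+ k *m leader_input R n m) i j) 0; first by rewrite mul0r.
by have := set_dist_le_walk dist lL wk; rewrite leqNgt lt_kd.
Qed.

(** * A positive vector in the controllability span *)

Definition ctrb_span (R : realType) n m (A : 'M[R]_n) (B : 'M[R]_(n, m))
    (N : nat) (z : 'cV[R]_n) : Prop :=
  exists w : nat -> 'cV[R]_m, z = \sum_(k < N) A ^+ k *m B *m w k.

(** With the number [N] of steps fixed, the span is closed under addition
without padding of the input sequences. *)
Lemma ctrb_spanD (R : realType) n m (A : 'M[R]_n) (B : 'M[R]_(n, m)) N k c z v :
  ctrb_span A B N z -> (k < N)%N ->
  ctrb_span A B N (c *: (A ^+ k *m B *m v) + z).
Proof.
move=> [w ->] kN; exists (fun l => (if l == k then c *: v else 0) + w l).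
under [RHS]eq_bigr do rewrite mulmxDr.
rewrite big_split /=; congr (_ + _).
rewrite (bigD1 (Ordinal kN)) //= eqxx big1 ?addr0 ?scalemxAr // => l lk.
by rewrite -val_eqE /= in lk; rewrite (negPf lk) mulmx0.
Qed.

(** Back substitution along the block triangular matrix, from the last class to
the first: step [k] of the induction makes the vector positive on the followers
at distance more than [K - k].  The leaders, on which [B] is the identity, come
last. *)
Lemma leader_follower_positive_ctrb (R : realType) n m K (A : 'M[R]_n) :
  leader_follower m A K ->
  (forall k, (1 <= k <= K)%N -> exists v : 'cV[R]_m, forall i,
     0 < (Phi m A k *m v) i ord0) ->
  exists2 z, ctrb_span A (leader_input R n m) K.+1 z & forall i, 0 < z i ord0.
Proof.
move=> LF PhiP; set B := leader_input R n m.
have far k : (k <= K)%N -> exists2 z : 'cV[R]_n, ctrb_span A B K.+1 z &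
    forall i d, i \in followers n m -> is_set_dist A (leaders n m) i d ->
      (K - k < d)%N -> 0 < z i ord0.
  elim: k => [_|k IH ltkK].
    exists 0; first by exists (fun=> 0); rewrite big1 // => k _; rewrite mulmx0.
    move=> i d iF dist; rewrite subn0 => /(lf_max LF) Fd0.
    have : i \in follower_class m A d by rewrite inE iF; apply/asboolP.
    by rewrite Fd0 inE.
  have [z zS zP] := IH (ltnW ltkK).
  have lvl : (1 <= K - k <= K)%N by rewrite subn_gt0 ltkK leq_subr.
  have [v vP] := PhiP _ lvl.
  have vF i : i \in follower_class m A (K - k) ->
      0 < (A ^+ (K - k) *m B *m v) i ord0.
    move=> iF; have := vP (enum_rank_in iF i); rewrite /Phi.
    by rewrite mul_rowsub_mx [X in _ < X]mxE enum_rankK_in.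
  have [c c_gt0 cP] := exists_dominating_scale
    (P := mem (follower_class m A (K - k))) (fun i => - z i ord0) vF.
  exists (c *: (A ^+ (K - k) *m B *m v) + z).
    by apply: ctrb_spanD; rewrite // ltnS leq_subr.
  move=> i d iF dist; rewrite subnS prednK ?subn_gt0 // leq_eqVlt.
  rewrite 2!mxE => /orP[/eqP dE|lt_d].
    have /cP : i \in follower_class m A (K - k).
      by rewrite inE iF; apply/asboolP; rewrite dE.
    by rewrite -subr_gt0 opprK.
  rewrite (early_response_eq0 _ dist lt_d) mulr0 add0r.
  exact: zP dist lt_d.
have [z zS zP] := far K (leqnn K).
(* [A ^+ 0] only gives this vector the shape that [ctrb_spanD] expects. *)
pose b : 'cV[R]_n := A ^+ 0 *m B *m const_mx 1.
have bE i : b i ord0 = (i < m)%:R.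
  rewrite /b expr0 mul1mx mxE.
  under eq_bigr do rewrite !mxE mulr1.
  case: ltnP => im; last by rewrite big1 // => j _; rewrite andbF.
  rewrite (bigD1 (Ordinal im)) //= eqxx big1 ?addr0 // => j ji.
  by rewrite eq_sym -val_eqE /= in ji; rewrite (negPf ji).
have [c c_gt0 cP] : exists2 c, 0 < c & forall i : 'I_n, (i < m)%N ->
    - z i ord0 < c * b i ord0.
  by apply: exists_dominating_scale => i im; rewrite bE im.
exists (c *: b + z); first exact: ctrb_spanD.
move=> i; rewrite 2!mxE.
have [im|mi] := ltnP i m; first by have := cP _ im; rewrite -subr_gt0 opprK.
have iF : i \in followers n m by rewrite inE.
rewrite bE ltnNge mi mulr0 add0r.
have [d dist] := lf_finite LF iF; apply: (zP i d iF dist).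
rewrite subnn lt0n; apply/eqP => d0.
have [[l lL [[p [_ lp sp]] _]] _] := dist.
have p0 : p = [::] by apply: size0nil; rewrite sp d0.
by move: lp lL; rewrite p0 /= => ->; rewrite inE ltnNge mi.
Qed.

(** * Herdability in discrete time *)

(** The input plays the coefficients of the combination backwards.  Giving the
state in Horner form makes the recurrence a shift of the summation index. *)
Lemma positive_ctrb_herdable_dt (R : realType) n m (A : 'M[R]_n)
    (B : 'M[R]_(n, m)) N z :
  ctrb_span A B N.+1 z -> (forall i, 0 < z i ord0) -> herdable_dt A B.
Proof.
move=> [w zE] z_gt0 x0 h h_gt0.
have [c _ cP] := exists_dominating_scale (P := predT)
  (fun i => h - (A ^+ N.+1 *m x0) i ord0) (fun i _ => z_gt0 i).
exists N.+1, (fun t => c *: w (N - t)%N),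
  (fun t => A ^+ t *m x0 + c *: \sum_(k < t) A ^+ k *m B *m w (N.+1 - t + k)%N).
split => //.
- move=> t lt_tN; rewrite big_ord_recl mulmxDr mulmxA -[A *m A ^+ t]exprS.
  rewrite -addrA; congr (_ + _); rewrite expr0 mul1mx addn0 subSS.
  rewrite scalerDr addrC -!scalemxAr; congr (_ + _).
  rewrite mulmx_sumr; congr (_ *: _); apply: eq_bigr => k _ /=.
  by rewrite /bump /= add1n addnS -addSn -subSn // !mulmxA -[A *m A ^+ k]exprS.
- by rewrite expr0 mul1mx big_ord0 scaler0 addr0.
- move=> i; rewrite subnn -zE mxE [X in _ <= _ + X]mxE.
  by rewrite addrC -lerBlDr ltW // cP.
Qed.

(** * Exponential generating functions *)

(** Asking for [1 <= M] makes [M ^+ r] nondecreasing in [r], so that delaying a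
sequence keeps its bound. *)
Definition geometric_bound (R : realType) (a : nat -> R) : Prop :=
  exists D M : R, [/\ 0 <= D, 1 <= M & forall r, `|a r| <= D * M ^+ r].

Lemma geometric_boundD (R : realType) (a b : nat -> R) :
  geometric_bound a -> geometric_bound b ->
  geometric_bound (fun r => a r + b r).
Proof.
move=> [D1 [M1 [D1_ge0 M1_ge1 aP]]] [D2 [M2 [D2_ge0 M2_ge1 bP]]].
have M12 : M1 <= M1 + M2 /\ M2 <= M1 + M2 by split; lra.
exists (D1 + D2), (M1 + M2); split; [lra|lra|move=> r].
rewrite (le_trans (ler_normD _ _)) // mulrDl lerD //.
  rewrite (le_trans (aP r)) // ler_wpM2l // lerXn2r ?nnegrE; lra.
rewrite (le_trans (bP r)) // ler_wpM2l // lerXn2r ?nnegrE; lra.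
Qed.

Lemma geometric_boundZ (R : realType) c (a : nat -> R) :
  geometric_bound a -> geometric_bound (fun r => c * a r).
Proof.
move=> [D [M [D_ge0 M_ge1 aP]]].
exists (`|c| * D), M; split => // [|r]; first by rewrite mulr_ge0.
by rewrite normrM -mulrA ler_wpM2l.
Qed.

Lemma geometric_bound_shift (R : realType) (a : nat -> R) :
  geometric_bound a -> geometric_bound (fun r => a r.+1).
Proof.
move=> [D [M [D_ge0 M_ge1 aP]]].
exists (D * M), M; split => // [|r]; first by rewrite mulr_ge0 //; lra.
by rewrite -mulrA -exprS.
Qed.

Lemma geometric_bound_impulse (R : realType) q (c : R) :
  geometric_bound (fun r => if r == q then c else 0).
Proof.
exists `|c|, 1; split => // r; rewrite expr1n mulr1.
by case: eqP => // _; rewrite normr0.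
Qed.

Definition egf (R : realType) (a : nat -> R) (t : R) : R :=
  limn (pseries (fun r => a r / r`!%:R) t).

Lemma egf_cvg (R : realType) (a : nat -> R) t :
  geometric_bound a -> cvgn (pseries (fun r => a r / r`!%:R) t).
Proof.
move=> [D [M [D_ge0 M_ge1 aP]]]; apply: normed_cvg.
have M_ge0 : 0 <= M by lra.
apply: (@series_le_cvg _ _ (D *: exp_coeff (M * `|t|))) => [r|r|r|].
- exact: normr_ge0.
- change (0 <= D * exp_coeff (M * `|t|) r).
  by rewrite mulr_ge0 // /exp_coeff /= divr_ge0 // exprn_ge0 // mulr_ge0.
- change (`|a r / r`!%:R * t ^+ r| <= D * exp_coeff (M * `|t|) r).
  rewrite normrM normrX normrM normfV [`|r`!%:R|]ger0_norm //.
  rewrite /exp_coeff /= exprMn.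
  rewrite mulrAC [leRHS]mulrA ler_wpM2r ?invr_ge0 //.
  by rewrite mulrA ler_wpM2r // exprn_ge0.
- exact/is_cvg_seriesZ/is_cvg_series_exp_coeff.
Qed.

Lemma egf_linear (R : realType) c (a b : nat -> R) t :
  geometric_bound a -> geometric_bound b ->
  egf (fun r => c * a r + b r) t = c * egf a t + egf b t.
Proof.
move=> ga gb; have Ca := egf_cvg (t := t) ga; have Cb := egf_cvg (t := t) gb.
rewrite /egf -[c * _](lim_seriesZ _ Ca) -lim_seriesD //; last first.
  exact: is_cvg_seriesZ.
congr (limn (series _)); apply/funext => r /=.
by rewrite !fctE /= !mulrDl -!mulrA.
Qed.

Lemma egf_impulse1 (R : realType) q (c : R) :
  egf (fun r => if r == q then c else 0) 1 = c / q`!%:R.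
Proof.
apply: lim_near_cst => //; exists q.+1 => // N /= lt_qN.
rewrite /pseries /series /= big_mkord (bigD1 (Ordinal lt_qN)) //=.
rewrite eqxx expr1n mulr1.
rewrite big1 ?addr0 // => r rq.
by rewrite -val_eqE /= in rq; rewrite (negPf rq) !mul0r.
Qed.

Lemma egf_at0 (R : realType) (a : nat -> R) : egf a 0 = a 0%N.
Proof.
apply: lim_near_cst => //; exists 1%N => // -[|N] // _.
rewrite /pseries /series /= big_mkord big_ord_recl /= expr0 fact0 divr1 mulr1.
by rewrite big1 ?addr0 // => r _; rewrite expr0n mulr0.
Qed.

(** The division by factorials is there for this: differentiation becomes a
shift of the sequence. *)
Lemma is_derive_egf (R : realType) (a : nat -> R) (t : R) :
  geometric_bound a ->
  is_derive t (1 : R) (egf a) (egf (fun r => a r.+1) t).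
Proof.
move=> ga.
have diffsE b : pseries_diffs (fun r => b r / r`!%:R : R) =
    (fun r => b r.+1 / r`!%:R).
  apply/funext => r; rewrite /pseries_diffs factS natrM invfM.
  by rewrite mulrCA mulVKf // pnatr_eq0.
rewrite /egf -(diffsE a).
apply: (@pseries_snd_diffs _ (fun r => a r / r`!%:R) (`|t| + 1)).
- exact: egf_cvg.
- by rewrite diffsE; exact/egf_cvg/geometric_bound_shift/ga.
- rewrite !diffsE.
  exact/(@egf_cvg _ (fun r => a r.+2))/(geometric_bound_shift
    (geometric_bound_shift ga)).
- by rewrite [ltRHS]ger0_norm ?ltrDl // addr_ge0.
Qed.

(** Delaying a sequence by [q] gains a factor [q!], because
[q! r! <= (q + r)!]; the remaining sum is below the exponential series. *)
Lemma egf_delayed_bound (R : realType) q (a : nat -> R) D M :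
  0 <= D -> 0 <= M -> (forall r, (r < q)%N -> a r = 0) ->
  (forall r, `|a (q + r)%N| <= D * M ^+ r) ->
  `|egf a 1| <= D * expR M / q`!%:R.
Proof.
move=> D_ge0 M_ge0 a0 aP.
pose b r := a (q + r)%N / (q + r)`!%:R.
have Cb : cvgn (series ((D / q`!%:R) *: exp_coeff M)).
  exact/is_cvg_seriesZ/is_cvg_series_exp_coeff.
have le_b r : `|b r| <= ((D / q`!%:R) *: exp_coeff M) r.
  change (`|b r| <= D / q`!%:R * (M ^+ r / r`!%:R)).
  rewrite /b normrM normfV [`|_`!%:R|]ger0_norm // mulrACA -invfM.
  rewrite ler_pM // ?invr_ge0 // lef_pV2 ?posrE.
  - rewrite -natrM ler_nat -(bin_fact (leq_addr r q)) addKn.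
    by rewrite leq_pmull // bin_gt0 leq_addr.
  - by rewrite ltr0n fact_gt0.
  - by rewrite -natrM ltr0n muln_gt0 !fact_gt0.
have Cnb : cvgn [normed series b].
  apply: (series_le_cvg _ _ le_b) => // r.
  exact: le_trans (le_b r).
have -> : egf a 1 = limn (series b).
  apply: cvg_lim => //; rewrite -(cvg_shiftn q).
  suff -> : [sequence pseries (fun r => a r / r`!%:R) 1 (n + q)%N]_n = series b.
    exact: normed_cvg.
  apply/funext => N; rewrite /pseries /series /= addnC.
  rewrite (big_cat_nat (n := q)) ?leq_addr //= big_nat big1 ?add0r.
    rewrite -[X in \sum_(X <= _ < _) _]add0n big_addn addKn.
    by apply: eq_bigr => r _; rewrite expr1n mulr1 addnC.
  by move=> r /andP[_ /a0 ->]; rewrite !mul0r.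
apply: (le_trans (lim_series_norm Cnb)).
rewrite (le_trans (lim_series_le Cnb Cb le_b)) // lim_seriesZ.
  by rewrite [_ *: _]/(_ * _) mulrAC.
exact: is_cvg_series_exp_coeff.
Qed.

Lemma egf_sum (R : realType) (I : Type) (s : seq I) (c : I -> R)
    (a : I -> nat -> R) t : (forall j, geometric_bound (a j)) ->
  geometric_bound (fun r => \sum_(j <- s) c j * a j r) /\
  egf (fun r => \sum_(j <- s) c j * a j r) t = \sum_(j <- s) c j * egf (a j) t.
Proof.
move=> ga; elim: s => [|j s [gs IH]].
  rewrite (_ : (fun _ => _) = (fun=> 0)); last first.
    by apply/funext => r; rewrite big_nil.
  split; first by exists 0, 1; split => // r; rewrite normr0 mul0r.
  rewrite big_nil; apply: lim_near_cst => //; apply: nearW => N.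
  by rewrite /pseries /series /= big1 // => r _; rewrite !mul0r.
rewrite (_ : (fun r => _) =
    (fun r => c j * a j r + \sum_(j <- s) c j * a j r)); last first.
  by apply/funext => r; rewrite big_cons.
split; first exact: geometric_boundD (geometric_boundZ _ _) _.
by rewrite big_cons egf_linear // IH.
Qed.

(** * From discrete to continuous trajectories *)

Definition geometric_bound_cV (R : realType) n (a : nat -> 'cV[R]_n) : Prop :=
  forall i, geometric_bound (fun r => a r i ord0).

Definition egf_cV (R : realType) n (a : nat -> 'cV[R]_n) (t : R) : 'cV[R]_n :=
  \col_i egf (fun r => a r i ord0) t.

Lemma geometric_bound_cV_linear (R : realType) n c (a b : nat -> 'cV[R]_n) :
  geometric_bound_cV a -> geometric_bound_cV b ->
  geometric_bound_cV (fun r => c *: a r + b r).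
Proof.
move=> ga gb i; rewrite (_ : (fun r => _) =
    (fun r => c * a r i ord0 + b r i ord0)); last first.
  by apply/funext => r; rewrite !mxE.
exact: geometric_boundD (geometric_boundZ _ (ga i)) (gb i).
Qed.

Lemma egf_cV_linear (R : realType) n c (a b : nat -> 'cV[R]_n) t :
  geometric_bound_cV a -> geometric_bound_cV b ->
  egf_cV (fun r => c *: a r + b r) t = c *: egf_cV a t + egf_cV b t.
Proof.
move=> ga gb; apply/colP => i; rewrite !mxE -egf_linear //.
by congr egf; apply/funext => r; rewrite !mxE.
Qed.

Lemma geometric_bound_cV_impulse (R : realType) n q (v : 'cV[R]_n) :
  geometric_bound_cV (fun r => if r == q then v else 0).
Proof.
move=> i; rewrite (_ : (fun r => _) =
    (fun r => if r == q then v i ord0 else 0)); last first.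
  by apply/funext => r; case: eqP => // _; rewrite mxE.
exact: geometric_bound_impulse.
Qed.

Lemma egf_cV_impulse1 (R : realType) n q (v : 'cV[R]_n) :
  egf_cV (fun r => if r == q then v else 0) 1 = q`!%:R^-1 *: v.
Proof.
apply/colP => i; rewrite !mxE mulrC -egf_impulse1; congr egf.
by apply/funext => r; case: eqP => // _; rewrite mxE.
Qed.

Lemma egf_cV_at0 (R : realType) n (a : nat -> 'cV[R]_n) : egf_cV a 0 = a 0%N.
Proof. by apply/colP => i; rewrite mxE egf_at0. Qed.

Definition response (R : realType) n m (A : 'M[R]_n) (B : 'M[R]_(n, m))
    (u : nat -> 'cV[R]_m) (a : nat -> 'cV[R]_n) : Prop :=
  [/\ geometric_bound_cV u, geometric_bound_cV a
    & forall r, a r.+1 = A *m a r + B *m u r].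

(** Both sides of the differential equation are generating functions, of the
shifted state and of [A a + B u]; they agree coefficientwise by the discrete
recurrence. *)
Lemma egf_ct_trajectory (R : realType) n m (A : 'M[R]_n) (B : 'M[R]_(n, m))
    (u : nat -> 'cV[R]_m) (a : nat -> 'cV[R]_n) tf :
  response A B u a -> ct_trajectory A B tf (egf_cV u) (egf_cV a).
Proof.
move=> [gu ga rec].
have cont p (b : nat -> 'cV[R]_p) i : geometric_bound_cV b ->
    {within `[0, tf], continuous (fun t => egf_cV b t i ord0)}%classic.
  move=> gb; apply: continuous_subspaceT => t.
  rewrite (_ : (fun t => _) = egf (fun r => b r i ord0)); last first.
    by apply/funext => s; rewrite mxE.
  apply/differentiable_continuous/derivable1_diffP.
  by have [] := is_derive_egf t (gb i).
split=> [j|i|t i _]; [exact: cont|exact: cont|].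
rewrite (_ : (fun t => _) = egf (fun r => a r i ord0)); last first.
  by apply/funext => s; rewrite mxE.
have [gAx Ax] := egf_sum (index_enum 'I_n) (A i) t ga.
have [gBu Bu] := egf_sum (index_enum 'I_m) (B i) t gu.
rewrite [X in is_derive _ _ _ X](_ : _ = egf (fun r => a r.+1 i ord0) t).
  exact: is_derive_egf.
rewrite !mxE.
under eq_bigr do rewrite mxE.
under [X in _ + X]eq_bigr do rewrite mxE.
rewrite -Ax -Bu -[X in X + _]mul1r -egf_linear //; congr egf.
by apply/funext => r; rewrite rec !mxE mul1r.
Qed.

(** * Delayed orbits and their endpoints *)

Lemma expmx_bound (R : realType) n (A : 'M[R]_n) (z : 'cV[R]_n) :
  exists D M, [/\ 0 <= D, 1 <= M
    & forall r i, `|(A ^+ r *m z) i ord0| <= D * M ^+ r].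
Proof.
pose D := \sum_i `|z i ord0|; pose M := 1 + \sum_i \sum_j `|A i j|.
have D_ge0 : 0 <= D by exact: sumr_ge0.
have S_ge0 : 0 <= \sum_i \sum_j `|A i j|.
  by apply: sumr_ge0 => i _; apply: sumr_ge0.
exists D, M; split => //; first by rewrite lerDl.
have M_ge0 : 0 <= M by rewrite addr_ge0.
elim=> [|r IH] i.
  by rewrite expr0 mul1mx mulr1 /D (bigD1 i) //= lerDl sumr_ge0.
rewrite exprS -[A * _]/(A *m _) -mulmxA mxE (le_trans (ler_norm_sum _ _ _)) //.
rewrite (@le_trans _ _ (\sum_j `|A i j| * (D * M ^+ r))) //.
  by apply: ler_sum => j _; rewrite normrM ler_wpM2l.
rewrite -mulr_suml exprS [leRHS]mulrCA ler_wpM2r ?mulr_ge0 ?exprn_ge0 //.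
rewrite /M [X in _ <= 1 + X](bigD1 i) //= addrCA lerDl addr_ge0 //.
by apply: sumr_ge0 => j _; apply: sumr_ge0.
Qed.

(** The state of the discrete system that is at rest and jumps to [z] at step
[q].  Its generating function at time 1 is the vector
[E_q z = sum_r A^r z / (q + r)!]. *)
Definition delayed_orbit (R : realType) n (A : 'M[R]_n) q (z : 'cV[R]_n)
    (r : nat) : 'cV[R]_n :=
  if (r < q)%N then 0 else A ^+ (r - q) *m z.

Lemma geometric_bound_delayed_orbit (R : realType) n (A : 'M[R]_n) q z :
  geometric_bound_cV (delayed_orbit A q z).
Proof.
move=> i; have [D [M [D_ge0 M_ge1 zP]]] := expmx_bound A z.
have M_ge0 : 0 <= M by lra.
exists D, M; split => // r; rewrite /delayed_orbit.
case: ifP => _; first by rewrite mxE normr0 mulr_ge0 ?exprn_ge0.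
by rewrite (le_trans (zP _ _)) // ler_wpM2l // ler_weXn2l // leq_subr.
Qed.

Lemma delayed_orbitS (R : realType) n (A : 'M[R]_n) q z r :
  delayed_orbit A q z r =
  (if r == q then z else 0) + delayed_orbit A q.+1 (A *m z) r.
Proof.
rewrite /delayed_orbit ltnS; case: ltngtP => [lt_rq|lt_qr|->].
- by rewrite addr0.
- rewrite add0r mulmxA subnS.
  by rewrite -[X in A ^+ X *m z]prednK ?subn_gt0 // exprSr.
- by rewrite subnn expr0 mul1mx addr0.
Qed.

Lemma delayed_orbit_rec (R : realType) n (A : 'M[R]_n) q z r :
  delayed_orbit A q.+1 z r.+1 =
  A *m delayed_orbit A q.+1 z r + (if r == q then z else 0).
Proof.
rewrite /delayed_orbit !ltnS subSS; case: ltngtP => [lt_rq|lt_qr|->].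
- by rewrite mulmx0 addr0.
- rewrite addr0 mulmxA subnS.
  by rewrite -[X in A ^+ X *m z]prednK ?subn_gt0 // exprS.
- by rewrite subnn expr0 mul1mx mulmx0 add0r.
Qed.

(** [E_q z = z / q! + E_(q+1) (A z)]: the first term of the series is split
off. *)
Lemma delayed_orbit_endpointS (R : realType) n (A : 'M[R]_n) q z :
  egf_cV (delayed_orbit A q z) 1 =
  q`!%:R^-1 *: z + egf_cV (delayed_orbit A q.+1 (A *m z)) 1.
Proof.
rewrite -egf_cV_impulse1 -[X in X + _]scale1r -egf_cV_linear.
- by congr (egf_cV _ _); apply/funext => r; rewrite scale1r delayed_orbitS.
- exact: geometric_bound_cV_impulse.
- exact: geometric_bound_delayed_orbit.
Qed.

Lemma delayed_orbit_endpoint_bound (R : realType) n (A : 'M[R]_n) z :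
  exists2 C : R, 0 <= C & forall q i,
    `|egf_cV (delayed_orbit A q z) 1 i ord0| <= C / q`!%:R.
Proof.
have [D [M [D_ge0 M_ge1 zP]]] := expmx_bound A z.
exists (D * expR M); first by rewrite mulr_ge0 // expR_ge0.
move=> q i; rewrite mxE; apply: egf_delayed_bound => // [|r lt_rq|r].
- by lra.
- by rewrite /delayed_orbit lt_rq mxE.
- by rewrite /delayed_orbit ltnNge leq_addr addKn; exact: zP.
Qed.

(** * States approachable at time 1 *)

(** Only inputs and states that are generating functions are considered: they
form a vector space, and they suffice to approach the controllability span. *)
Definition reachable1 (R : realType) n m (A : 'M[R]_n) (B : 'M[R]_(n, m))
    (z : 'cV[R]_n) : Prop :=
  exists u a, [/\ response A B u a, a 0%N = 0 & z = egf_cV a 1].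

Lemma response_linear (R : realType) n m (A : 'M[R]_n) (B : 'M[R]_(n, m))
    c u a u' a' : response A B u a -> response A B u' a' ->
  response A B (fun r => c *: u r + u' r) (fun r => c *: a r + a' r).
Proof.
move=> [gu ga rec] [gu' ga' rec'].
split; [exact: geometric_bound_cV_linear|exact: geometric_bound_cV_linear|].
by move=> r; rewrite rec rec' !mulmxDr -!scalemxAr scalerDr addrACA.
Qed.

Lemma reachable1_linear (R : realType) n m (A : 'M[R]_n) (B : 'M[R]_(n, m))
    c y z : reachable1 A B y -> reachable1 A B z ->
  reachable1 A B (c *: y + z).
Proof.
move=> [u [a [ra a0 ->]]] [u' [a' [ra' a'0 ->]]].
exists (fun r => c *: u r + u' r), (fun r => c *: a r + a' r); split.
- exact: response_linear.
- by rewrite a0 a'0 scaler0 addr0.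
- by have [_ ga _] := ra; have [_ ga' _] := ra'; rewrite egf_cV_linear.
Qed.

Lemma reachable1_impulse (R : realType) n m (A : 'M[R]_n) (B : 'M[R]_(n, m))
    q v : reachable1 A B (egf_cV (delayed_orbit A q.+1 (B *m v)) 1).
Proof.
exists (fun r => if r == q then v else 0), (delayed_orbit A q.+1 (B *m v)).
split => //; split.
- exact: geometric_bound_cV_impulse.
- exact: geometric_bound_delayed_orbit.
- by move=> r; rewrite delayed_orbit_rec; case: eqP; rewrite // mulmx0.
Qed.

Definition almost_reachable1 (R : realType) n m (A : 'M[R]_n)
    (B : 'M[R]_(n, m)) (z : 'cV[R]_n) : Prop :=
  forall e : R, 0 < e ->
    exists2 y, reachable1 A B y & forall i, `|y i ord0 - z i ord0| < e.

Lemma almost_reachable1W (R : realType) n m (A : 'M[R]_n) (B : 'M[R]_(n, m)) z :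
  reachable1 A B z -> almost_reachable1 A B z.
Proof. by move=> rz e e_gt0; exists z => // i; rewrite subrr normr0. Qed.

Lemma almost_reachable1_closed (R : realType) n m (A : 'M[R]_n)
    (B : 'M[R]_(n, m)) (z : 'cV[R]_n) :
  (forall e : R, 0 < e ->
     exists2 y : 'cV[R]_n, almost_reachable1 A B y &
       forall i, `|y i ord0 - z i ord0| < e) ->
  almost_reachable1 A B z.
Proof.
move=> zP e e_gt0; have e2_gt0 : 0 < e / 2 by rewrite divr_gt0.
have [y yW yz] := zP _ e2_gt0; have [x xR xy] := yW _ e2_gt0.
exists x => // i; rewrite (splitr e).
rewrite (le_lt_trans (ler_distD (y i ord0) _ _)) // ltrD //.
Qed.

Lemma almost_reachable1_linear (R : realType) n m (A : 'M[R]_n)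
    (B : 'M[R]_(n, m)) c y z :
  almost_reachable1 A B y -> almost_reachable1 A B z ->
  almost_reachable1 A B (c *: y + z).
Proof.
move=> yW zW e e_gt0.
have k_gt0 : 0 < `|c| + 1 by rewrite ltr_wpDl.
have e1_gt0 : 0 < e / 2 / (`|c| + 1) by rewrite !divr_gt0.
have e2_gt0 : 0 < e / 2 by rewrite divr_gt0.
have [y' y'R y'P] := yW _ e1_gt0; have [z' z'R z'P] := zW _ e2_gt0.
exists (c *: y' + z'); first exact: reachable1_linear.
move=> i; rewrite !mxE opprD addrACA -mulrBr (splitr e).
rewrite (le_lt_trans (ler_normD _ _)) // ler_ltD // normrM.
rewrite (@le_trans _ _ ((`|c| + 1) * (e / 2 / (`|c| + 1)))) //.
  by rewrite ler_pM // ?lerDl // ltW.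
by rewrite mulrC divfK // gt_eqF.
Qed.

(** [q! E_q z = z + q! E_(q+1) (A z)], and the last term is at most
[C / (q + 1)]; so if [E_q z] is approachable for all large [q], then so is [z]
([limit]), and hence so is [E_(q+1) (A z)].  Starting from [z = B v], for which
[E_q z] is reachable when [0 < q], this climbs the sequence [A^k B v].  The
range [k < q] shrinks at each step, which does no harm to the limit. *)
Lemma almost_reachable1_krylov (R : realType) n m (A : 'M[R]_n)
    (B : 'M[R]_(n, m)) k v : almost_reachable1 A B (A ^+ k *m B *m v).
Proof.
have limit z q0 : (forall q, (q0 < q)%N ->
    almost_reachable1 A B (egf_cV (delayed_orbit A q z) 1)) ->
  almost_reachable1 A B z.
  move=> zW; apply: almost_reachable1_closed => e e_gt0.
  have [C C_ge0 CP] := delayed_orbit_endpoint_bound A (A *m z).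
  (* Large enough for [zW] and for [C / (q + 1) < e]. *)
  pose q := (q0 + Num.truncn (C / e)).+1.
  exists (q`!%:R *: egf_cV (delayed_orbit A q z) 1).
    have W0 : almost_reachable1 A B 0.
      rewrite -(subrr (egf_cV (delayed_orbit A q z) 1)) addrC -scaleN1r.
      by apply: almost_reachable1_linear; apply: zW; rewrite ltnS leq_addr.
    rewrite -[X in almost_reachable1 _ _ X]addr0.
    by apply: almost_reachable1_linear => //; apply: zW; rewrite ltnS leq_addr.
  move=> i; have fq : (q`!%:R : R) != 0 by rewrite pnatr_eq0 -lt0n fact_gt0.
  rewrite delayed_orbit_endpointS scalerDr scalerA divff // scale1r.
  rewrite mxE addrAC subrr add0r mxE normrM ger0_norm //.
  rewrite (@le_lt_trans _ _ (C / q.+1%:R)) //.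
    rewrite (le_trans (ler_wpM2l _ (CP _ _))) //.
    rewrite (factS q) natrM invfM mulrCA [X in C * X <= _]mulrCA divff //.
    by rewrite mulr1.
  rewrite ltr_pdivrMr // mulrC -ltr_pdivrMr //.
  rewrite (lt_le_trans (truncnS_gt _)) // ler_nat.
  by rewrite ltnW // !ltnS leq_addl.
suff H : forall q, (k < q)%N ->
    almost_reachable1 A B (egf_cV (delayed_orbit A q (A ^+ k *m B *m v)) 1).
  exact: limit H.
elim: k => [|k IH] [//|q].
  by rewrite expr0 mul1mx => _; exact/almost_reachable1W/reachable1_impulse.
rewrite ltnS => lt_kq.
have -> : A ^+ k.+1 *m B *m v = A *m (A ^+ k *m B *m v).
  by rewrite exprS !mulmxA.
have /esym := delayed_orbit_endpointS A q (A ^+ k *m B *m v).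
rewrite addrC => /(canRL (addrK _)) ->; rewrite addrC -scaleNr.
by apply: almost_reachable1_linear; [exact: limit IH|exact: IH].
Qed.

Lemma almost_reachable1_ctrb_span (R : realType) n m (A : 'M[R]_n)
    (B : 'M[R]_(n, m)) N z : ctrb_span A B N z -> almost_reachable1 A B z.
Proof.
move=> [w ->].
apply: (big_ind (almost_reachable1 A B)) => [|x y xW yW|k _].
- by have := almost_reachable1_krylov A B 0 0; rewrite mulmx0.
- by rewrite -[x]scale1r; exact: almost_reachable1_linear.
- exact: almost_reachable1_krylov.
Qed.

(** * Herdability in continuous time *)

(** Approximation is enough: an error below the smallest entry of [z] keeps a
reachable vector positive. *)
Lemma positive_ctrb_herdable_ct (R : realType) n m (A : 'M[R]_n)
    (B : 'M[R]_(n, m)) N z :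
  ctrb_span A B N z -> (forall i, 0 < z i ord0) -> herdable_ct A B.
Proof.
move=> /almost_reachable1_ctrb_span zW z_gt0 x0 h h_gt0.
(* [1 < c * z i] for all [i] says that [c^-1] is below every entry of [z]. *)
have [c c_gt0 cP] := exists_dominating_scale (P := predT)
  (fun=> 1) (fun i _ => z_gt0 i).
have ci_gt0 : 0 < c^-1 by rewrite invr_gt0.
have [y [u [a [ra a0 yE]]] yP] := zW _ ci_gt0.
have y_gt0 i : 0 < y i ord0.
  have := yP i; have := cP i isT; rewrite mulrC -ltr_pdivrMr // mul1r.
  by rewrite ltr_norml => ? /andP[? _]; lra.
pose a0' := delayed_orbit A 0 x0.
have ra0 : response A B (fun=> 0) a0'.
  split; [|exact: geometric_bound_delayed_orbit|].
    by move=> i; exists 0, 1; split => // r; rewrite mxE normr0 mul0r.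
  by move=> r; rewrite /a0' /delayed_orbit !subn0 mulmx0 addr0 mulmxA
    -[A *m A ^+ r]exprS.
have [d _ dP] := exists_dominating_scale (P := predT)
  (fun i => h - egf_cV a0' 1 i ord0) (fun i _ => y_gt0 i).
have rd := response_linear d ra ra0.
exists 1, (egf_cV (fun r => d *: u r + 0)),
  (egf_cV (fun r => d *: a r + a0' r)).
split => //; first exact: egf_ct_trajectory.
  rewrite egf_cV_at0 a0 scaler0 add0r /a0' /delayed_orbit /=.
  by rewrite expr0 mul1mx.
move=> i; have [_ ga _] := ra; have [_ ga0 _] := ra0.
rewrite egf_cV_linear // -yE mxE [X in X + _]mxE -lerBlDr ltW //.
exact: dP.
Qed.

(** * Herdability of the leader-follower network *)

Theorem proposition5 (R : realType) (n m K : nat) (A : 'M[R]_n)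
  (hmn : (m <= n)%N)
  (hLF : leader_follower m A K)
  (hrows : forall k : nat, (1 <= k <= K)%N ->
     forall i : 'I_(#|follower_class m A k|), row i (Phi m A k) <> 0)
  (hH : forall k : nat, (1 <= k <= K)%N ->
     (#|follower_class m A k| - 1 <= #|unisigned_support m A k|)%N) :
  herdable A (leader_input R n m).
Proof.
have PhiP k : (1 <= k <= K)%N -> exists v : 'cV[R]_m, forall i,
    0 < (Phi m A k *m v) i ord0.
  move=> kK; apply: almost_covered_positive_image; first exact: hrows.
  rewrite (leq_trans (hH k kK)) // /unisigned_support.
  by under eq_bigl do rewrite inE.
have [z zS z_gt0] := leader_follower_positive_ctrb hLF PhiP.
split; first exact: positive_ctrb_herdable_ct zS z_gt0.
exact: positive_ctrb_herdable_dt zS z_gt0.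
Qed.
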